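(* Let $\mathscr{U}=(U,B,\pi)$ be an ultimate Urysohn field. The moduli space $(\mathcal{F},d_{GH})$ of isomorphism classes of compact fields, equipped with the Gromov–Hausdorff distance, is isometric to the quotient space $(F(\mathscr{U})/\mathrm{Aut}(\mathscr{U}),d_F^{\mathscr{U}})$.
   Context: A Polish space means a complete separable metric space. A field $\mathscr{X}=(X,B_X,\pi_X)$ is a $1$-Lipschitz map $\pi_X\colon X\to B_X$ between Polish spaces; it is compact if its domain $X$ is compact. Codomains of fields are allowed to vary over all Polish spaces. A one-point extension of a metric space $A$ is a metric space $A^\ast=A\sqcup\{a^\ast\}$ whose metric restricts to the given one on $A$. A field $\pi\colon U\to B$ is an ultimate Urysohn field if for any finite (possibly empty) subspaces $A\subseteq U$ and $Z\subseteq B$ with $\pi(A)\subseteq Z$, any one-point extensions $A^\ast$ of $A$ and $Z^\ast$ of $Z$, and any $1$-Lipschitz map $p\colon A^\ast\to Z^\ast$ with $p|_A=\pi|_A$, there exist isometric embeddings $\imath\colon A^\ast\to U$ and $\jmath\colon Z^\ast\to B$ such that $\imath|_A$ and $\jmath|_Z$ are the inclusion maps and $\pi\circ\imath=\jmath\circ p$. An isometric embedding of fields $\Phi\colon\mathscr{X}\Rightarrow\mathscr{Y}$ is a pair of isometric embeddings of metric spaces $f\colon X\to Y$ and $g\colon B_X\to B_Y$ with $\pi_Y\circ f=g\circ\pi_X$. If both $f$ and $g$ are also surjective, $\Phi$ is called an isometry, and $\mathscr{X}$ and $\mathscr{Y}$ are called isometric (isomorphic) if there is an isometry between them. $\mathcal{F}$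 denotes the set of isomorphism (isometry) classes of compact fields, with arbitrary Polish codomains. For compact fields $\mathscr{X},\mathscr{Y}$, the Gromov–Hausdorff distance is $$d_{GH}(\mathscr{X},\mathscr{Y}):=\inf d_H^Z(f(X),f'(Y)),$$ where the infimum is over all compact fields $\mathscr{Z}=(Z,B_Z,\pi_Z)$ and all isometric embeddings $(f,g)\colon\mathscr{X}\Rightarrow\mathscr{Z}$ and $(f',g')\colon\mathscr{Y}\Rightarrow\mathscr{Z}$, and $d_H^Z$ is the Hausdorff distance in $Z$. $F(\mathscr{U})$ is the space of compact subfields of $\mathscr{U}$ (restrictions of $\pi$ to compact subsets of $U$), with the Hausdorff distance $d_H^U$ between the domains of the subfields. $\mathrm{Aut}(\mathscr{U})$ is the automorphism group of $\mathscr{U}$, i.e. the group of pairs $(\varphi,\psi)$ of bijective isometries $\varphi\colon U\to U$, $\psi\colon B\to B$ with $\pi\circ\varphi=\psi\circ\pi$; it acts on compact subfields by moving the domain $A$ to $\varphi(A)$. The quotient metric induced by the Hausdorff distance is, for compact subfields with domains $A,A'\subseteq U$, $$d_F^{\mathscr{U}}([A],[A'])=\inf_{(\varphi,\psi)\in\mathrm{Aut}(\mathscr{U})}d_H^U(A,\varphi(A')).$$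
   Formalization: Since d_GH vanishes between some non-isomorphic fields (a point over a one-point or a two-point codomain), ''isometric'' is read after identifying classes at distance 0: a distance-preserving surjection onto F(U)/Aut(U) that identifies exactly those classes. *)

(* Defs.v *)
From mathcomp Require Import all_boot all_order all_algebra.
From mathcomp Require Import all_classical all_reals all_analysis.

Set Implicit Arguments.
Unset Strict Implicit.
Unset Printing Implicit Defensive.

Import Order.TTheory GRing.Theory Num.Theory.
Import numFieldNormedType.Exports.

Local Open Scope classical_set_scope.
Local Open Scope ring_scope.

(** * Polish spaces and fields *)

Definition nonexpansive (R : realType) (S T : metricType R) (f : S -> T) :=
  forall x y, mdist (f x) (f y) <= mdist x y.

Definition isometric_embedding (R : realType) (S T : metricType R)
    (f : S -> T) :=
  forall x y, mdist (f x) (f y) = mdist x y.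

(* [completeType] is not used here because it forces the space to be
   nonempty. *)
Definition complete_space (R : realType) (T : metricType R) :=
  forall F : set_system T, ProperFilter F -> cauchy F ->
    exists x : T, F --> x.

Definition separable_space (R : realType) (T : metricType R) :=
  exists2 D : set T, countable D & dense D.

Definition polish (R : realType) (T : metricType R) :=
  complete_space T /\ separable_space T.

Record metric_field (R : realType) := MetricField {
  dom : metricType R ;
  cod : metricType R ;
  proj : dom -> cod ;
  dom_polish : polish dom ;
  cod_polish : polish cod ;
  proj_nonexpansive : nonexpansive proj }.

Definition compact_field (R : realType) (X : metric_field R) :=
  compact [set: dom X].

Definition field_embedding (R : realType) (X Y : metric_field R)
    (f : dom X -> dom Y) (g : cod X -> cod Y) :=
  [/\ isometric_embedding f, isometric_embedding g &
      forall x, proj (f x) = g (proj x)].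

Definition field_isometry (R : realType) (X Y : metric_field R)
    (f : dom X -> dom Y) (g : cod X -> cod Y) :=
  [/\ field_embedding f g, range f = [set: dom Y] & range g = [set: cod Y]].

Definition isometric_fields (R : realType) (X Y : metric_field R) :=
  exists f g, @field_isometry R X Y f g.

(** * Ultimate Urysohn fields *)

Definition is_metric (R : realType) (T : Type) (d : T -> T -> R) :=
  [/\ forall x y, 0 <= d x y,
      forall x y, d x y = 0 <-> x = y,
      forall x y, d x y = d y x &
      forall x y z, d x z <= d x y + d y z].

(* The extension of A is carried by [option A], the new point being [None]. *)
Definition one_point_extension (R : realType) (T : metricType R) (A : set T)
    (d : option A -> option A -> R) :=
  is_metric d /\
  forall a b : A, d (Some a) (Some b) = mdist (\val a) (\val b).

Definition ultimate_urysohn (R : realType) (U : metric_field R) :=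
  forall (A : set (dom U)) (Z : set (cod U)),
    finite_set A -> finite_set Z -> @proj R U @` A `<=` Z ->
  forall (dA : option A -> option A -> R) (dZ : option Z -> option Z -> R),
    one_point_extension dA -> one_point_extension dZ ->
  forall p : option A -> option Z,
    (forall x y, dZ (p x) (p y) <= dA x y) ->
    (forall a : A, omap \val (p (Some a)) = Some (proj (\val a))) ->
  exists (i : option A -> dom U) (j : option Z -> cod U),
    [/\ forall x y, mdist (i x) (i y) = dA x y,
        forall x y, mdist (j x) (j y) = dZ x y,
        forall a : A, i (Some a) = \val a,
        forall z : Z, j (Some z) = \val z &
        forall x, proj (i x) = j (p x)].

(** * Hausdorff and Gromov-Hausdorff distances *)

(* Joining 0 to the supremum only matters when A is empty.  For nonempty compact
   sets this is the usual finite value; the distance between the empty set and a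
   nonempty set is +oo, and that of the empty set to itself is 0. *)
Definition hausdorff_excess (R : realType) (T : metricType R) (A B : set T) :
    \bar R :=
  ereal_sup (0%E |`
    [set ereal_inf [set (mdist a b)%:E | b in B] | a in A]).

Definition hausdorff_dist (R : realType) (T : metricType R) (A B : set T) :
    \bar R :=
  maxe (hausdorff_excess A B) (hausdorff_excess B A).

Definition gh_dist (R : realType) (X Y : metric_field R) : \bar R :=
  ereal_inf [set r | exists (Z : metric_field R)
      (f : dom X -> dom Z) (g : cod X -> cod Z)
      (f' : dom Y -> dom Z) (g' : cod Y -> cod Z),
    [/\ compact_field Z, field_embedding f g, field_embedding f' g' &
        r = hausdorff_dist (range f) (range f')]].

(** * Quotients *)

Definition quotient (T : Type) (E : T -> T -> Prop) :=
  {C : T -> Prop | exists x, C = E x}.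

Definition class_of (T : Type) (E : T -> T -> Prop) (x : T) : quotient E :=
  exist _ (E x) (ex_intro _ x erefl).

Definition class_repr (T : Type) (E : T -> T -> Prop) (c : quotient E) : T :=
  projT1 (cid (proj2_sig c)).

Definition quotient_dist (R : realType) (T : Type) (E : T -> T -> Prop)
    (d : T -> T -> \bar R) (c c' : quotient E) : \bar R :=
  d (class_repr c) (class_repr c').

Lemma quotient_distE (R : realType) (T : Type) (E : T -> T -> Prop)
    (d : T -> T -> \bar R) :
  (forall x, E x x) ->
  (forall x x' y y', E x x' -> E y y' -> d x y = d x' y') ->
  forall x y, quotient_dist d (class_of E x) (class_of E y) = d x y.
Proof.
move=> Exx dE x y; have reprE z : E z (class_repr (class_of E z)).
  rewrite /class_repr; case: cid => /= z' zz'.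
  by rewrite zz'; exact: Exx.
by apply/esym/dE; exact: reprE.
Qed.

(** * The moduli space of compact fields *)

Definition compact_fields (R : realType) := {X : metric_field R | compact_field X}.

Definition isometric_compact_fields (R : realType) (X Y : compact_fields R) :=
  isometric_fields (sval X) (sval Y).

Definition moduli (R : realType) := quotient (@isometric_compact_fields R).

(* This is only a pseudometric: a one-point field and the same field with
   a point added to its codomain are at distance 0 but are not isometric.  An
   isometry from the moduli space onto a metric space thus identifies exactly
   the classes at distance 0. *)
Definition moduli_dist (R : realType) : moduli R -> moduli R -> \bar R :=
  quotient_dist (fun X Y : compact_fields R => gh_dist (sval X) (sval Y)).

(** * The quotient of the space of compact subfields *)

(* A compact subfield of U is given by its domain, a compact subset of U; the
   codomain is always that of U. *)
Definition compact_subfields (R : realType) (U : metric_field R) :=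
  {A : set (dom U) | compact A}.

Definition same_orbit (R : realType) (U : metric_field R)
    (A A' : compact_subfields U) :=
  exists phi psi, @field_isometry R U U phi psi /\ sval A' = phi @` sval A.

Definition orbit_space (R : realType) (U : metric_field R) :=
  quotient (@same_orbit R U).

Definition subfield_dist (R : realType) (U : metric_field R)
    (A A' : compact_subfields U) : \bar R :=
  ereal_inf [set r | exists phi psi, @field_isometry R U U phi psi /\
    r = hausdorff_dist (sval A) (phi @` sval A')].

Definition orbit_dist (R : realType) (U : metric_field R) :
    orbit_space U -> orbit_space U -> \bar R :=
  quotient_dist (@subfield_dist R U).

(** * The distances do not depend on the representatives *)

Lemma field_isometry_id (R : realType) (X : metric_field R) :
  @field_isometry R X X id id.
Proof. by split=> //; rewrite image_id. Qed.

Lemma field_embedding_comp (R : realType) (X Y Z : metric_field R)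
    (f : dom X -> dom Y) (g : cod X -> cod Y)
    (f' : dom Y -> dom Z) (g' : cod Y -> cod Z) :
  field_embedding f g -> field_embedding f' g' ->
  field_embedding (f' \o f) (g' \o g).
Proof.
move=> [hf hg hfg] [hf' hg' hfg']; split=> /=.
- by move=> x y /=; rewrite hf' hf.
- by move=> x y /=; rewrite hg' hg.
- by move=> x; rewrite hfg' hfg.
Qed.

Lemma range_surj_comp (S T V : Type) (f : S -> T) (g : T -> V) :
  range f = [set: T] -> range (g \o f) = range g.
Proof. by move=> sf; rewrite -(image_comp f g) [X in g @` X]sf. Qed.

Lemma field_isometry_comp (R : realType) (X Y Z : metric_field R)
    (f : dom X -> dom Y) (g : cod X -> cod Y)
    (f' : dom Y -> dom Z) (g' : cod Y -> cod Z) :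
  field_isometry f g -> field_isometry f' g' ->
  field_isometry (f' \o f) (g' \o g).
Proof.
move=> [e sf sg] [e' sf' sg']; split; first exact: field_embedding_comp e e'.
- by rewrite range_surj_comp.
- by rewrite range_surj_comp.
Qed.

Lemma isometric_inverse (R : realType) (S T : metricType R) (f : S -> T) :
  isometric_embedding f -> range f = [set: T] ->
  exists h : T -> S, [/\ isometric_embedding h, cancel f h & cancel h f].
Proof.
move=> hf sf.
have /choice[h fh] : forall y, exists x, f x = y.
  by move=> y; have [x _ <-] : range f y by [rewrite sf]; exists x.
have hfK : cancel f h.
  by move=> x; apply: (@mdist_positivity R); rewrite -hf fh mdistxx.
by exists h; split=> // x y; rewrite -hf !fh.
Qed.

Lemma field_isometry_inv (R : realType) (X Y : metric_field R)
    (f : dom X -> dom Y) (g : cod X -> cod Y) :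
  field_isometry f g ->
  exists f' g', [/\ @field_isometry R Y X f' g', cancel f f', cancel f' f,
                    cancel g g' & cancel g' g].
Proof.
move=> [[hf hg hfg] sf sg].
have [f' [hf' fK f'K]] := isometric_inverse hf sf.
have [g' [hg' gK g'K]] := isometric_inverse hg sg.
exists f', g'; split=> //; split; first split=> // y.
- by rewrite -[RHS]gK g'K -{2}(f'K y) hfg gK.
- by rewrite -subTset => x _; exists (f x).
- by rewrite -subTset => x _; exists (g x).
Qed.

Lemma hausdorff_dist_isometric (R : realType) (S T : metricType R) (f : S -> T)
    (A B : set S) :
  isometric_embedding f ->
  hausdorff_dist (f @` A) (f @` B) = hausdorff_dist A B.
Proof.
move=> hf; have exE C D : hausdorff_excess (f @` C) (f @` D) =
    hausdorff_excess C D.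
  rewrite /hausdorff_excess; congr (ereal_sup (_ |` _)).
  rewrite image_comp; apply: eq_imagel => a _ /=; rewrite image_comp.
  by congr ereal_inf; apply: eq_imagel => b _ /=; rewrite hf.
by rewrite /hausdorff_dist !exE.
Qed.

Lemma gh_dist_isometric (R : realType) (X X' Y Y' : metric_field R) :
  isometric_fields X X' -> isometric_fields Y Y' ->
  gh_dist X Y = gh_dist X' Y'.
Proof.
have le (V V' W W' : metric_field R) : isometric_fields V V' ->
    isometric_fields W W' -> (gh_dist V' W' <= gh_dist V W)%E.
  move=> [f [g /field_isometry_inv[f1 [g1 [[e1 s1 _] _ _ _ _]]]]].
  move=> [h [k /field_isometry_inv[h1 [k1 [[e2 s2 _] _ _ _ _]]]]].
  apply/ereal_inf_le_tmp.
  move=> _ [Z [a [b [a' [b' [cZ ea ea' ->]]]]]].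
  exists Z, (a \o f1), (b \o g1), (a' \o h1), (b' \o k1); split=> //.
  - exact: field_embedding_comp e1 ea.
  - exact: field_embedding_comp e2 ea'.
  - by rewrite !range_surj_comp.
have sym (V V' : metric_field R) : isometric_fields V V' -> isometric_fields V' V.
  by move=> [f [g /field_isometry_inv[f1 [g1 []]]]]; exists f1, g1.
by move=> XX' YY'; apply/le_anti; rewrite !le// ; exact: sym.
Qed.

Lemma moduli_distE (R : realType) (X Y : compact_fields R) :
  moduli_dist (class_of _ X) (class_of _ Y) = gh_dist (sval X) (sval Y).
Proof.
rewrite /moduli_dist quotient_distE//.
- by move=> {}X; exists id, id; exact: field_isometry_id.
- by move=> ? ? ? ?; exact: gh_dist_isometric.
Qed.

Lemma orbit_distE (R : realType) (U : metric_field R) (A A' : compact_subfields U) :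
  orbit_dist (class_of _ A) (class_of _ A') = subfield_dist A A'.
Proof.
have le (B B' C C' : compact_subfields U) : same_orbit B B' ->
    same_orbit C C' -> (subfield_dist B' C' <= subfield_dist B C)%E.
  move=> [f [g [fg BE]]] [h [k [hk CE]]]; apply/ereal_inf_le_tmp.
  move=> _ [a [b [ab ->]]].
  have [h1 [k1 [hk1 hK _ _ _]]] := field_isometry_inv hk.
  exists (f \o a \o h1), (g \o b \o k1); split.
    by apply: (field_isometry_comp hk1); exact: field_isometry_comp ab fg.
  have [[hf _ _] _ _] := fg.
  rewrite BE CE -(hausdorff_dist_isometric _ _ hf); congr hausdorff_dist.
  by rewrite !image_comp; apply: eq_imagel => x _ /=; rewrite hK.
have sym (B B' : compact_subfields U) : same_orbit B B' -> same_orbit B' B.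
  move=> [f [g [/field_isometry_inv[f1 [g1 [i1 fK _ _ _]]] BE]]].
  exists f1, g1; split=> //; rewrite BE image_comp.
  by rewrite -[LHS]image_id; apply: eq_imagel => x _ /=; rewrite fK.
rewrite /orbit_dist quotient_distE//.
- by move=> B; exists id, id; split; [exact: field_isometry_id|rewrite image_id].
- by move=> B B' C C' BB' CC'; apply/le_anti; rewrite !le//; exact: sym.
Qed.

(* Main.v *)
From HB Require Import structures.
From mathcomp Require Import all_boot all_order all_algebra.
From mathcomp Require Import all_classical all_reals all_analysis.
From mathcomp Require Import lra.
Require Import Defs.

(** An ultimate Urysohn field U is universal and homogeneous for compact fields,
and the theorem follows from these two facts alone.

Universality (embeds_in_ultimate) gives every compact field X an embedding in
U, and Phi sends the class of X to the orbit of the range of its embedding.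
Homogeneity (partial_isometry_extends) makes the choice of the embedding
irrelevant, as two embeddings of X differ by an automorphism
(embeddings_conjugate); so Phi is onto, a compact subfield A being the range of
its own inclusion.  A compact field containing X and Y can itself be placed in
U, and two positions of X and Y in U span a compact subfield of U; hence both
distances are infima of the same set of numbers (gh_dist_embedded).  Finally an
orbit distance is 0 only between equal orbits: automorphisms moving A' towards
A converge pointwise on A' along an ultrafilter, and homogeneity turns the limit
into an automorphism taking A' onto A (subfield_dist_eq0).

The defining property of U only speaks of finite subspaces.  It yields two
one-point properties: points of the codomain, and points of the domain over a
given point of the codomain, can be found at prescribed distances from finitely
many points.  Both have the same form, a gauge function confining the new point
to its zero set.  Completeness extends them from finite to totally bounded sets
(realizes_over_totally_bounded), by correcting approximate solutions with
geometrically decreasing errors.  Partial isomorphisms with totally bounded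
domain can thus be enlarged by any one point, and going forth, or back and
forth, through dense sequences gives universality and homogeneity. *)

Set Implicit Arguments.
Unset Strict Implicit.
Unset Printing Implicit Defensive.

Import Order.TTheory GRing.Theory Num.Theory.
Import numFieldNormedType.Exports.
Import metricType_numDomainType.

Local Open Scope classical_set_scope.
Local Open Scope ring_scope.

(** * Metric spaces *)

Section MetricSpaces.
Variable R : realType.
Implicit Types S T : metricType R.

Definition totally_bounded T (K : set T) := forall e : R, 0 < e ->
  exists F : set T, [/\ finite_set F, F `<=` K &
    forall x, K x -> exists2 y, F y & mdist x y < e].

Lemma eq_of_close (a b : R) : (forall e, 0 < e -> `|a - b| <= e) -> a = b.
Proof.
move=> h; apply/eqP; rewrite -subr_eq0 -normr_le0; apply/ler_addgt0Pl => e /h.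
by rewrite addr0.
Qed.

Lemma nbhs_mdist T (x : T) (e : R) : 0 < e -> \forall y \near x, mdist x y < e.
Proof. by move=> e0; apply/nbhs_mdistP; exists e. Qed.

Lemma nonexpansive_continuous S T (f : S -> T) :
  nonexpansive f -> continuous f.
Proof.
move=> hf x; apply/cvgrPdist_lt => e e0.
near=> y; apply: le_lt_trans (hf _ _) _; near: y; exact: nbhs_mdist.
Unshelve. all: by end_near. Qed.

Lemma nonexpansive_compact_image S T (f : S -> T) A :
  compact A -> nonexpansive f -> compact (f @` A).
Proof.
move=> cA hf; apply: continuous_compact => //.
exact/continuous_subspaceT/nonexpansive_continuous.
Qed.

Lemma isometric_nonexpansive S T (f : S -> T) :
  isometric_embedding f -> nonexpansive f.
Proof. by move=> hf x y; rewrite hf. Qed.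

Lemma mdist_eq0 T (x y : T) : mdist x y <= 0 -> x = y.
Proof.
by move=> h; apply/(@mdist_positivity R)/le_anti; rewrite h mdist_ge0.
Qed.

Lemma mdist_eq_small T (x y : T) : (forall e, 0 < e -> mdist x y <= e) -> x = y.
Proof. by move=> h; apply/mdist_eq0/ler_addgt0Pl => e /h; rewrite addr0. Qed.

Lemma mdist_quadrilateral T (a b a' b' : T) :
  `|mdist a b - mdist a' b'| <= mdist a a' + mdist b b'.
Proof.
have := metric_triangle a a' b; have := metric_triangle a' b' b.
have := metric_triangle a' a b'; have := metric_triangle a b b'.
rewrite (metric_sym b' b) (metric_sym a' a) => ? ? ? ?.
by rewrite ler_norml; apply/andP; split; lra.
Qed.

Lemma dense_mdist T (D : set T) : dense D ->
  forall x (e : R), 0 < e -> exists2 y, D y & mdist x y < e.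
Proof.
move=> dD x e e0.
have [||y [xy Dy]] := dD (interior [set y | mdist x y < e]).
- exists x; exact: nbhs_mdist.
- exact: open_interior.
- by exists y => //; move: (interior_subset xy).
Qed.

Lemma mdist_dense T (D : set T) :
  (forall x (e : R), 0 < e -> exists2 y, D y & mdist x y < e) -> dense D.
Proof.
move=> hD O [x Ox] oO.
have /nbhs_mdistP[e e0 eO] : \forall y \near x, O y by exact: open_nbhs_nbhs.
by have [y Dy xy] := hD x e e0; exists y; split=> //; exact: eO.
Qed.

(** The finite subsets of K, directed by inclusion, form a filter along which
every point of K is eventually close to the net; compactness, read as the
near-covering property, makes this uniform over K. *)
Lemma compact_totally_bounded T (K : set T) : compact K -> totally_bounded K.
Proof.
move=> /compact_near_coveringP cK e e0.
pose fin (F : set T) := finite_set F /\ F `<=` K.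
pose G : set_system (set T) := [set B | exists2 F0, fin F0 &
  forall F, fin F -> F0 `<=` F -> B F].
have GF : Filter G.
  split=> [|B C [F [fF FK] hB] [F' [fF' FK'] hC]|B C BC [F fF hB]].
  - by exists set0 => //; split.
  - exists (F `|` F'); first by split; [rewrite finite_setU|rewrite subUset].
    by move=> H fH; rewrite subUset => -[FH FH']; split; [exact: hB|exact: hC].
  - by exists F => // H fH FH; exact/BC/hB.
pose near_net (F : set T) x := exists2 y, F y & mdist x y < e.
have [x Kx|F fF hF] := cK _ G near_net GF.
  exists ([set y | mdist x y < e], [set F | F x]) => /=; last first.
    by move=> [y F] /= [xy Fx]; exists x => //; rewrite metric_sym.
  split; first exact: nbhs_mdist.
  exists [set x]; last by move=> F _; apply.
  by split; [exact: finite_set1|move=> _ ->].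
have [fF1 FK] := fF.
by exists F; split=> //; move=> x Kx; exact: (hF F fF (subset_refl _) x Kx).
Qed.

Lemma compact_space_polish T : compact [set: T] -> polish T.
Proof.
move=> cT; split.
  move=> F FF /cauchy_ballP Fc.
  have [x [_ xF]] := cT F FF filterT.
  exists x; apply/fcvgrPdist_lt => e e0.
  have e2 : 0 < e / 2 by rewrite divr_gt0.
  have := Fc _ e2; rewrite near_map2 => -[[A B] /= [FA FB] AB].
  have [y [Ay xy]] := xF A _ FA (nbhs_mdist x e2).
  apply: filterS FB => z Bz.
  have := AB (y, z) (conj Ay Bz); rewrite /= ballEmdist/= => yz.
  by rewrite (splitr e) (le_lt_trans (metric_triangle x y z))// ltrD.
have /choice[F hF] (n : nat) : exists F : set T, finite_set F /\
    forall x, exists2 y, F y & mdist x y < n.+1%:R^-1.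
  have [|F [fF _ hF]] := @compact_totally_bounded _ _ cT n.+1%:R^-1.
    by rewrite invr_gt0.
  by exists F; split=> // x; exact: hF.
exists (\bigcup_n F n).
  apply: bigcup_countable => // n _; apply: finite_set_countable.
  by have [] := hF n.
apply: mdist_dense => x e e0.
have [n ne] : exists n, n.+1%:R^-1 < e :> R.
  near \oo => n; exists n; near: n.
  exact: near_infty_natSinv_lt (PosNum e0).
have [_ /(_ x)[y Fy xy]] := hF n.
by exists y; [exists n|exact: lt_trans ne].
Unshelve. all: by end_near. Qed.

Lemma half_powers_small (e : R) : 0 < e ->
  exists N, forall n, (N <= n)%N -> 2^-1 ^+ n < e.
Proof.
move=> e0; have : (2^-1 ^+ n @[n --> \oo] --> (0:R)).
  by apply: cvg_expr; rewrite ger0_norm// invf_lt1// ltr1n.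
by move/cvgr_lt => /(_ _ e0)[N _ hN]; exists N.
Qed.

Lemma geometric_cvg T (u : nat -> T) : complete_space T ->
  (forall n, mdist (u n) (u n.+1) <= 2^-1 ^+ n) ->
  exists x, forall e : R, 0 < e ->
    exists N, forall n, (N <= n)%N -> mdist (u n) x < e.
Proof.
move=> cT hu.
have step n m :
    mdist (u n) (u (n + m)%N) <= 2 * 2^-1 ^+ n - 2 * 2^-1 ^+ (n + m) :> R.
  elim: m => [|m IH]; first by rewrite addn0 mdistxx subrr.
  rewrite (le_trans (metric_triangle _ (u (n + m)%N) _))// addnS.
  rewrite (le_trans (lerD IH (hu _)))// exprS; lra.
have tail n m : (n <= m)%N -> mdist (u n) (u m) <= 2 * 2^-1 ^+ n.
  by move=> nm; rewrite -(subnKC nm) (le_trans (step _ _))// gerBl mulr_ge0//.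
have ucau : cauchy (u @ \oo).
  apply: cauchy_exP => e e0.
  have [N hN] := half_powers_small (divr_gt0 e0 (ltr0n _ 2)).
  exists (u N), N => // m /= Nm; rewrite ballEmdist/=.
  by rewrite (le_lt_trans (tail _ _ Nm))// mulrC -ltr_pdivlMr// hN.
have [x ux] := cT _ _ ucau; exists x => e e0.
have /cvgrPdist_lt/(_ _ e0)[N _ hN] : u @ \oo --> x by [].
by exists N => n Nn; rewrite metric_sym; exact: hN.
Qed.

End MetricSpaces.

(** * Realizing prescribed distances *)

Lemma dependent_chain (T : Type) (P : nat -> T -> Prop)
    (r : nat -> T -> T -> Prop) (x0 : T) : P 0%N x0 ->
  (forall n x, P n x -> exists2 y, P n.+1 y & r n x y) ->
  exists2 u : nat -> T, u 0%N = x0 &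
    forall n, P n (u n) /\ r n (u n) (u n.+1).
Proof.
move=> P0 step.
have /choice[next hnext] (nx : nat * T) : exists y,
    P nx.1 nx.2 -> P nx.1.+1 y /\ r nx.1 nx.2 y.
  have [Pn|nPn] := pselect (P nx.1 nx.2); last by exists x0.
  by have [y Py ry] := step _ _ Pn; exists y.
pose u := fix u n := if n is m.+1 then next (m, u m) else x0.
have Pu n : P n (u n).
  by elim: n => //= n IH; have [] := hnext (n, u n) IH.
by exists u => // n; split=> //; have [] := hnext (n, u n) (Pu n).
Qed.

Section OnePointExtensions.
Variable R : realType.
Implicit Types T : metricType R.

(** The functions e on K that can be the distances to a new point. *)
Definition katetov_on T (K : set T) (e : T -> R) := forall x y, K x -> K y ->
  e x <= mdist x y + e y /\ mdist x y <= e x + e y.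

(** The gauge g confines the new point to the set where g <= 0.  Only two gauges
matter: the zero gauge, for points of the codomain, and the distance from a
given b to the projection, which confines to the fibre over b.  In the second
case g <= e is what makes the extended projection 1-Lipschitz. *)
Definition realizes_over T (g : T -> R) (K : set T) := forall e,
  katetov_on K e -> (forall k, K k -> g k <= e k) ->
  exists2 x, g x <= 0 & forall k, K k -> mdist x k = e k.

Lemma katetov_ge0 T (K : set T) e : katetov_on K e -> forall k, K k -> 0 <= e k.
Proof. by move=> Ke k Kk; have [_] := Ke k k Kk Kk; rewrite mdistxx; lra. Qed.

Lemma net_approximates T (K F : set T) e (d : R) x :
  katetov_on K e -> F `<=` K ->
  (forall k, K k -> exists2 f, F f & mdist k f < d / 2) ->
  (forall f, F f -> mdist x f = e f) ->
  forall k, K k -> `|mdist x k - e k| <= d.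
Proof.
move=> Ke FK hF xF k Kk; have [f Ff kf] := hF k Kk.
have [h1 _] := Ke _ _ Kk (FK _ Ff); have [h2 _] := Ke _ _ (FK _ Ff) Kk.
have h3 := metric_triangle x k f; have h4 := metric_triangle x f k.
move: h2 h3 h4; rewrite (metric_sym f k) (xF f Ff) => h2 h3 h4.
rewrite ler_norml; apply/andP; split; lra.
Qed.

(** Add the approximate solution x itself to a fine net of K and prescribe the
distance s from x to the new point, where s is the largest error of x on K:
the triangle inequality shows that this prescription is again a Katetov
function, and the correction moves x by no more than its error. *)
Lemma improve_realizer T (g : T -> R) (K : set T) e (eps d : R) x :
  (forall F, finite_set F -> realizes_over g F) -> totally_bounded K ->
  katetov_on K e -> (forall k, K k -> g k <= e k) -> K !=set0 ->
  0 < d -> g x <= 0 -> (forall k, K k -> `|mdist x k - e k| <= eps) ->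
  exists x', [/\ g x' <= 0, mdist x x' <= eps &
    forall k, K k -> `|mdist x' k - e k| <= d].
Proof.
move=> ext tb Ke ge [k0 Kk0] d0 gx xe.
have d2 : 0 < d / 2 by rewrite divr_gt0.
have [F [fF FK hF]] := tb _ d2.
pose E := [set `|mdist x k - e k| | k in K].
have E0 : E !=set0 by exists `|mdist x k0 - e k0|, k0.
have supE : has_sup E by split=> //; exists eps => _ [k Kk <-]; exact: xe.
pose s := sup E.
have sub k : K k -> `|mdist x k - e k| <= s.
  by move=> Kk; apply: ub_le_sup; [exact: supE.2|exists k].
have seps : s <= eps by apply: ge_sup => // _ [k Kk <-]; exact: xe.
have s0 : 0 <= s by apply: le_trans (sub _ Kk0).
have sK k : K k -> s <= mdist x k + e k.
  move=> Kk; apply: ge_sup => // _ [j Kj <-].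
  have [h1 h2] := Ke _ _ Kj Kk.
  have h3 := metric_triangle x j k; have h4 := metric_triangle x k j.
  have h5 := metric_triangle j x k.
  rewrite (metric_sym k j) in h4; rewrite (metric_sym j x) in h5.
  rewrite ler_norml; apply/andP; split; lra.
(* If x is in K, then s = e x, so that the two clauses agree. *)
pose e' y := if y == x then s else e y.
have e'F k : K k -> e' k = e k.
  rewrite /e'; case: eqP => // -> Kx; apply/le_anti.
  have := sK _ Kx; have := sub _ Kx; rewrite mdistxx !add0r normrN.
  by move=> h ->; rewrite (le_trans _ h)// ler_norm.
have e'x : e' x = s by rewrite /e' eqxx.
have sub' k : K k -> mdist x k <= s + e k /\ e k <= mdist x k + s.
  move=> /sub; rewrite ler_norml => /andP[? ?]; lra.
have [|||x' gx' x'F] := ext (x |` F) _ e'.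
- by rewrite finite_setU; split=> //; exact: finite_set1.
- move=> y z [->|/FK Ky] [->|/FK Kz].
  + by rewrite e'x mdistxx; lra.
  + by rewrite e'x (e'F _ Kz); have := sub' _ Kz; have := sK _ Kz; lra.
  + rewrite e'x (e'F _ Ky) metric_sym.
    by have := sub' _ Ky; have := sK _ Ky; lra.
  + by rewrite (e'F _ Ky) (e'F _ Kz); exact: Ke.
- move=> k [->|Fk]; first by rewrite e'x (le_trans gx).
  by rewrite e'F; [exact/ge/FK|exact: FK].
exists x'; split=> //; first by rewrite metric_sym x'F ?e'x//; left.
apply: net_approximates hF _ => // f Ff.
by rewrite x'F ?e'F//; [exact: FK|right].
Qed.

(** Finite sets suffice: successive corrections with errors 2^-n converge, by
completeness, to an exact solution. *)
Lemma realizes_over_totally_bounded T (g : T -> R) (K : set T) :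
  complete_space T -> (forall x y, g x <= mdist x y + g y) ->
  (forall F, finite_set F -> realizes_over g F) -> totally_bounded K ->
  realizes_over g K.
Proof.
move=> cT lg ext tb e Ke ge.
have [K0|/set0P K0] := eqVneq K set0.
  by apply: (ext _ _ e); rewrite ?K0// -K0.
have [x0 gx0 hx0] :
    exists2 x, g x <= 0 & forall k, K k -> `|mdist x k - e k| <= 1.
  have [|F [fF FK hF]] := tb (1 / 2); first by rewrite divr_gt0.
  have [||x gx xF] := ext F fF e.
  - by move=> y z Fy Fz; apply: Ke; exact: FK.
  - by move=> k /FK; exact: ge.
  by exists x => //; exact: net_approximates Ke FK hF xF.
pose P n x := g x <= 0 /\ forall k, K k -> `|mdist x k - e k| <= 2^-1 ^+ n.
have [||u _ hu] := @dependent_chain T P (fun n x y => mdist x y <= 2^-1 ^+ n) x0.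
- by split=> // k Kk; rewrite expr0; exact: hx0.
- move=> n x [gx hx].
  have h0 : 0 < 2^-1 ^+ n.+1 :> R by rewrite exprn_gt0// invr_gt0.
  by have [y [gy xy hy]] := improve_realizer ext tb Ke ge K0 h0 gx hx; exists y.
have [|x ux] := geometric_cvg cT (u := u); first by move=> n; have [] := hu n.
exists x => [|k Kk].
  apply/ler_addgt0Pl => d d0; have [N uN] := ux _ d0.
  have [[gu _] _] := hu N; have := lg x (u N); have := uN N (leqnn _).
  rewrite (metric_sym x); lra.
apply: eq_of_close => d d0; have d2 : 0 < d / 2 by rewrite divr_gt0.
have [N uN] := ux _ d2; have [M hM] := half_powers_small d2.
pose n := maxn N M.
have [[_ /(_ k Kk) hk] _] := hu n; move: hk.
have := uN n (leq_maxl _ _); have := hM n (leq_maxr _ _).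
have := metric_triangle x (u n) k; have := metric_triangle (u n) x k.
rewrite (metric_sym x (u n)) !ler_norml => h1 h2 h3 h4 /andP[h5 h6].
by apply/andP; split; lra.
Qed.

Definition one_point_dist T (A : set T) (e : T -> R) (x y : option A) : R :=
  match x, y with
  | Some a, Some b => mdist (\val a) (\val b)
  | Some a, None | None, Some a => e (\val a)
  | None, None => 0
  end.

Lemma one_point_distP T (A : set T) e : katetov_on A e ->
  (forall a, A a -> 0 < e a) -> one_point_extension (@one_point_dist T A e).
Proof.
move=> Ae e0; split=> //.
have Ap (a : A) : A (\val a) by exact: set_valP.
have e0' (a : A) : 0 < e (\val a) by exact: e0.
split.
- move=> [x|] [y|] //; rewrite /one_point_dist; try exact/ltW.
  exact: mdist_ge0.
- move=> [x|] [y|]; split=> //= h.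
  + by congr Some; apply/val_inj/(@mdist_positivity R).
  + by case: h => ->; rewrite mdistxx.
  + by move: (e0' x); rewrite h ltxx.
  + by move: (e0' y); rewrite h ltxx.
- by move=> [x|] [y|] //=; exact: metric_sym.
- move=> [x|] [y|] [z|] //=; rewrite ?add0r ?addr0//; try exact: metric_triangle.
  + by have [] := Ae _ _ (Ap x) (Ap y).
  + by have [_] := Ae _ _ (Ap x) (Ap z).
  + by have [h _] := Ae _ _ (Ap z) (Ap y); rewrite metric_sym addrC.
  + by have := e0' y; rewrite /=; lra.
Qed.

(** A point can be added to the codomain alone: take the empty subspace of the
domain, whose new point lies over the new point of the codomain. *)
Lemma ultimate_realizes_cod (U : metric_field R) : ultimate_urysohn U ->
  forall F : set (cod U), finite_set F -> realizes_over (fun=> 0) F.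
Proof.
move=> hU F fF e Fe _.
have [[k Fk ek]|e0] := pselect (exists2 k, F k & e k = 0).
  (* A function vanishing at k is the distance to k. *)
  exists k => // j Fj; have := Fe _ _ Fk Fj.
  by have := Fe _ _ Fj Fk; rewrite (metric_sym j k) ek; lra.
have eF : forall k, F k -> 0 < e k.
  move=> k Fk; rewrite lt_neqAle (katetov_ge0 Fe Fk) andbT eq_sym.
  by apply/eqP => ek; apply: e0; exists k.
have empty (a : @set0 (dom U)) : False by exact: (set_valP a).
have [|||||i [j [_ jd _ jF _]]] := hU set0 F (finite_set0 _) fF _
    (@one_point_dist _ set0 (fun=> 0)) (@one_point_dist _ F e) _ _
    (fun=> None).
- by rewrite image_set0.
- by apply: one_point_distP => [x y []|x []].
- exact: one_point_distP.
- move=> [a|] y; first by case: (empty a).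
  by case: y => // a; case: (empty a).
- by move=> a; case: (empty a).
exists (j None) => // k Fk.
by have := jd None (Some (SigSub (mem_set Fk))); rewrite jF.
Qed.

(** A point can be added over a given b.  The extension property also demands
a new point of the codomain; it is placed at distance 1 + d(b, z) from each z,
which is always admissible, and nothing lies over it. *)
Lemma ultimate_realizes_dom (U : metric_field R) : ultimate_urysohn U ->
  forall (b : cod U) (F : set (dom U)), finite_set F ->
  realizes_over (fun x => mdist b (proj x)) F.
Proof.
move=> hU b F fF e Fe be.
have [[k Fk ek]|e0] := pselect (exists2 k, F k & e k = 0).
  exists k; first by rewrite -ek; exact: be.
  move=> j Fj; have := Fe _ _ Fk Fj.
  by have := Fe _ _ Fj Fk; rewrite (metric_sym j k) ek; lra.
have eF : forall k, F k -> 0 < e k.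
  move=> k Fk; rewrite lt_neqAle (katetov_ge0 Fe Fk) andbT eq_sym.
  by apply/eqP => ek; apply: e0; exists k.
pose Z := b |` @proj R U @` F.
have Zb : b \in Z by apply: mem_set; left.
have ZF (a : F) : proj (\val a) \in Z.
  by apply: mem_set; right; exists (\val a) => //; exact: set_valP.
pose p (x : option F) : option Z :=
  Some (if x is Some a then SigSub (ZF a) else SigSub Zb).
have [||||||i [j [id _ iF jZ ij]]] := hU F Z fF _ _
    (@one_point_dist _ F e) (@one_point_dist _ Z (fun z => 1 + mdist b z)) _ _ p.
- rewrite finite_setU; split; [exact: finite_set1|exact: finite_image].
- by move=> z; right.
- exact: one_point_distP.
- apply: one_point_distP => [x y _ _|x _]; last by have := mdist_ge0 b x; lra.
  have := metric_triangle b y x; have := metric_triangle x b y.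
  by rewrite (metric_sym x b) (metric_sym y x); have := mdist_ge0 b x; lra.
- move=> [x|] [y|] /=; rewrite ?mdistxx//.
  + exact: proj_nonexpansive.
  + by rewrite metric_sym; apply/be/set_valP.
  + by apply/be/set_valP.
- by [].
exists (i None); first by rewrite ij jZ mdistxx.
by move=> k Fk; have := id None (Some (SigSub (mem_set Fk))); rewrite iF.
Qed.

End OnePointExtensions.

(** * Universality and homogeneity *)

Section PartialIsometries.
Variable R : realType.
Implicit Types S T : metricType R.
Implicit Types X Y : metric_field R.

(** Partial isometries are kept as relations, so that inverting, enlarging and
taking unions of them needs no choice of values; the condition forces such a
relation to be the graph of a partial bijection. *)
Definition isometric_rel S T (P : set (S * T)) :=
  forall p q, P p -> P q -> mdist p.1 q.1 = mdist p.2 q.2.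

Lemma isometric_rel_inv S T (P : set (S * T)) :
  isometric_rel P -> isometric_rel (P^-1)%relation.
Proof. by move=> hP p q Pp Pq; rewrite (hP _ _ Pp Pq). Qed.

Lemma fst_inv S T (M : set (S * T)) : fst @` (M^-1)%relation = snd @` M.
Proof. by apply/seteqP; split=> x [[a b] /= Mab <-]; exists (b, a). Qed.

Lemma isometric_rel_add S T (P : set (S * T)) s t : isometric_rel P ->
  (forall p, P p -> mdist s p.1 = mdist t p.2) -> isometric_rel ((s, t) |` P).
Proof.
move=> hP st p q [->|Pp] [->|Pq] /=; rewrite ?mdistxx//.
- exact: st.
- by rewrite metric_sym st// metric_sym.
- exact: hP.
Qed.

Lemma totally_boundedU1 T (K : set T) x :
  totally_bounded K -> totally_bounded (x |` K).
Proof.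
move=> tb e e0; have [F [fF FK hF]] := tb e e0.
exists (x |` F); split.
- by rewrite finite_setU; split=> //; exact: finite_set1.
- by move=> y [->|Fy]; [left|right; exact: FK].
- move=> y [->|/hF[z Fz yz]]; last by exists z => //; right.
  by exists x; [left|rewrite mdistxx].
Qed.

Lemma totally_bounded_snd S T (P : set (S * T)) : isometric_rel P ->
  totally_bounded (fst @` P) -> totally_bounded (snd @` P).
Proof.
move=> hP tb e e0; have [F [fF FP hF]] := tb e e0.
have [->|/set0P[p0 Pp0]] := eqVneq P set0.
  by exists set0; split=> [//|//|_ [p []]].
have /choice[h hh] s : exists t, (fst @` P) s -> P (s, t).
  have [[p Pp <-]|nPs] := pselect ((fst @` P) s); last by exists p0.2.
  by exists p.2 => _; case: p Pp.
exists (h @` F); split; first exact: finite_image.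
- by move=> _ [s Fs <-]; exists (s, h s) => //; exact/hh/FP.
- move=> _ [p Pp <-]; have [|s Fs ps] := hF p.1; first by exists p.
  exists (h s); first by exists s.
  by rewrite -(hP _ (s, h s))//; exact/hh/FP.
Qed.

(** The one-point step: transport along P the distances from s and realize them
in T. *)
Lemma realize_distances S T (g : T -> R) (P : set (S * T)) s :
  complete_space T -> (forall x y, g x <= mdist x y + g y) ->
  (forall F, finite_set F -> realizes_over g F) ->
  isometric_rel P -> totally_bounded (fst @` P) ->
  (forall p, P p -> g p.2 <= mdist s p.1) ->
  exists2 t, g t <= 0 & forall p, P p -> mdist s p.1 = mdist t p.2.
Proof.
move=> cT lg ext hP tb gP.
have /choice[e he] t : exists d, forall u, P (u, t) -> d = mdist s u.
  have [[u Pu]|nP] := pselect (exists u, P (u, t)); last first.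
    by exists 0 => u Pu; case: nP; exists u.
  exists (mdist s u) => v Pv; congr (mdist s _).
  by apply: (@mdist_positivity R); rewrite (hP _ _ Pu Pv) mdistxx.
have heP p : P p -> e p.2 = mdist s p.1 by case: p => u t /he.
have [||t gt tP] := realizes_over_totally_bounded cT lg ext
    (totally_bounded_snd hP tb) (e := e).
- move=> _ _ [p Pp <-] [q Pq <-]; rewrite !heP// -(hP _ _ Pp Pq).
  have := metric_triangle s q.1 p.1; have := metric_triangle p.1 s q.1.
  by rewrite (metric_sym q.1 p.1) (metric_sym p.1 s); lra.
- by move=> _ [p Pp <-]; rewrite heP//; exact: gP.
by exists t => // p Pp; rewrite -heP// tP//; exists p.
Qed.

(** Partial isomorphisms of fields.  Total boundedness is asked of the domains
only, since isometric relations carry it over to the ranges; it allows the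
construction to start from compact subfields, not just finite ones. *)
Definition partial_isometry X Y (P : set (dom X * dom Y))
    (Q : set (cod X * cod Y)) :=
  [/\ isometric_rel P, isometric_rel Q,
      forall p, P p -> Q (proj p.1, proj p.2),
      totally_bounded (fst @` P) & totally_bounded (fst @` Q)].

Lemma partial_isometry_inv X Y (P : set (dom X * dom Y)) Q :
  partial_isometry P Q -> partial_isometry (P^-1)%relation (Q^-1)%relation.
Proof.
move=> [hP hQ PQ tP tQ].
split; try exact: isometric_rel_inv.
- by move=> [y x] /= /PQ.
- by rewrite fst_inv; exact: totally_bounded_snd.
- by rewrite fst_inv; exact: totally_bounded_snd.
Qed.

Lemma extend_cod X Y (P : set (dom X * dom Y)) Q b : ultimate_urysohn Y ->
  partial_isometry P Q -> exists b', partial_isometry P ((b, b') |` Q).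
Proof.
move=> hY [hP hQ PQ tP tQ].
have [|b' _ hb] := realize_distances (s := b) (cod_polish Y).1 _
  (ultimate_realizes_cod hY) hQ tQ (fun _ _ => mdist_ge0 _ _).
  by move=> x y; rewrite addr0 mdist_ge0.
exists b'; split=> //.
- exact: isometric_rel_add.
- by move=> p /PQ; right.
- by rewrite image_setU image_set1; exact: totally_boundedU1.
Qed.

(** To reach x, first reach its projection, then realize x in the fibre over
the point found; the gauge condition holds since proj is 1-Lipschitz. *)
Lemma extend_dom X Y (P : set (dom X * dom Y)) Q x : ultimate_urysohn Y ->
  partial_isometry P Q -> exists x',
    partial_isometry ((x, x') |` P) ((proj x, proj x') |` Q).
Proof.
move=> hY PQ0; have [b' [hP hQ PQ tP tQ]] := extend_cod (proj x) hY PQ0.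
have [||x' bx' hx'] := realize_distances (s := x)
  (g := fun y => mdist b' (proj y)) (dom_polish Y).1 _
  (@ultimate_realizes_dom R Y hY b') hP tP _.
- move=> y z; rewrite addrC (le_trans (metric_triangle _ (proj z) _))//.
  by rewrite lerD2l metric_sym; exact: proj_nonexpansive.
- move=> p Pp; rewrite -(hQ (proj x, b') _ _ (PQ _ Pp)); last by left.
  exact: proj_nonexpansive.
exists x'; rewrite -(mdist_eq0 bx'); split=> //.
- exact: isometric_rel_add.
- by move=> p [->|/PQ//]; left; rewrite (mdist_eq0 bx').
- by rewrite image_setU image_set1; exact: totally_boundedU1.
Qed.

(** The option type lets the enumerated space be empty. *)
Definition enumerated T (u : nat -> option T) n (K : set T) :=
  forall y, u n = Some y -> K y.

Lemma separable_enumeration T : separable_space T ->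
  exists u : nat -> option T, forall K : set T,
    (forall n, enumerated u n K) -> dense K.
Proof.
move=> [D /countable_injP[f finj] dD].
have /choice[u hu] n : exists o, forall y, D y -> f y = n -> o = Some y.
  have [[y Dy <-]|nD] := pselect (exists2 y, D y & f y = n).
    exists (Some y) => z Dz fzy; congr Some; apply/esym/finj => //; exact: mem_set.
  by exists None => y Dy fy; case: nD; exists y.
exists u => K uK; apply: mdist_dense => x e e0.
have [y Dy xy] := dense_mdist dD x e0.
by exists y => //; apply: (uK (f y)); exact: hu.
Qed.

Lemma extend_enumerated X Y (u : nat -> option (dom X))
    (v : nat -> option (cod X)) n (P : set (dom X * dom Y)) Q :
  ultimate_urysohn Y -> partial_isometry P Q ->
  exists P' Q', [/\ partial_isometry P' Q', P `<=` P', Q `<=` Q',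
    enumerated u n (fst @` P') & enumerated v n (fst @` Q')].
Proof.
move=> hY PQ.
have [P1 [Q1 [PQ1 P01 Q01 uP1]]] : exists P' Q', [/\ partial_isometry P' Q',
    P `<=` P', Q `<=` Q' & enumerated u n (fst @` P')].
  rewrite /enumerated; case: (u n) => [x|]; last by exists P, Q; split.
  have [x' PQx] := extend_dom x hY PQ.
  exists ((x, x') |` P), ((proj x, proj x') |` Q); split=> //.
  by move=> _ [<-]; exists (x, x') => //; left.
rewrite /enumerated; case: (v n) => [b|]; last by exists P1, Q1; split.
have [b' PQb] := extend_cod b hY PQ1.
exists P1, ((b, b') |` Q1); split=> //.
- by move=> p /Q01; right.
- by move=> _ [<-]; exists (b, b') => //; left.
Qed.

(** The partners of the points close to s form a Cauchy filter; its limit is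
the partner of s. *)
Lemma isometric_rel_realize S T (P : set (S * T)) : complete_space T ->
  isometric_rel P -> dense (fst @` P) ->
  forall s, exists t, forall p, P p -> mdist s p.1 = mdist t p.2.
Proof.
move=> cT hP dP s.
have nearP (e : R) : 0 < e -> exists2 p, P p & mdist s p.1 < e.
  by move=> /(dense_mdist dP s)[_ [p Pp <-]]; exists p.
pose G : set_system T :=
  [set B | exists2 e : R, 0 < e & forall p, P p -> mdist s p.1 < e -> B p.2].
have GF : ProperFilter G.
  split.
    move=> [e e0 /=]; have [p Pp sp] := nearP _ e0.
    by move=> /(_ p Pp sp).
  split=> [|B C [e e0 hB] [d d0 hC]|B C BC [e e0 hB]].
  - by exists 1.
  - exists (Order.min e d); first by rewrite lt_min e0.
    by move=> p Pp; rewrite lt_min => /andP[pe pd]; split; [exact: hB|exact: hC].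
  - by exists e => // p Pp pe; exact/BC/hB.
have Gc : cauchy G.
  apply: cauchy_exP => e e0; have e2 : 0 < e / 2 by rewrite divr_gt0.
  have [p Pp sp] := nearP _ e2; exists p.2, (e / 2) => // q Pq sq.
  rewrite ballEmdist/= -(hP _ _ Pp Pq) (splitr e).
  by rewrite (le_lt_trans (metric_triangle _ s _))// ltrD// metric_sym.
have [t Gt] := cT G GF Gc; exists t => p Pp; apply: eq_of_close => e e0.
have e2 : 0 < e / 2 by rewrite divr_gt0.
have [d d0 hd] : \forall y \near G, mdist t y < e / 2.
  by move/fcvgrPdist_lt : Gt; apply.
have [|q Pq] := nearP (Order.min d (e / 2)); first by rewrite lt_min d0.
rewrite lt_min => /andP[qd qe]; have tq := hd q Pq qd.
have := metric_triangle s q.1 p.1; have := metric_triangle q.1 s p.1.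
have := metric_triangle t q.2 p.2; have := metric_triangle q.2 t p.2.
rewrite (hP _ _ Pq Pp) (metric_sym q.1 s) (metric_sym q.2 t) => ? ? ? ?.
rewrite ler_norml; apply/andP; split; lra.
Qed.

Lemma isometric_rel_extends S T (P : set (S * T)) : complete_space T ->
  isometric_rel P -> dense (fst @` P) ->
  exists2 f : S -> T, isometric_embedding f & forall p, P p -> f p.1 = p.2.
Proof.
move=> cT hP dP.
have /choice[f hf] := isometric_rel_realize cT hP dP.
exists f => [x y|p Pp]; last first.
  by apply: (@mdist_positivity R); rewrite -hf// mdistxx.
apply: eq_of_close => e e0; have e2 : 0 < e / 2 by rewrite divr_gt0.
have [_ [p Pp <-] yp] := dense_mdist dP y e2.
have hx := hf x p Pp; have hy := hf y p Pp.
have := metric_triangle x p.1 y; have := metric_triangle x y p.1.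
have := metric_triangle (f x) p.2 (f y).
have := metric_triangle (f x) (f y) p.2.
rewrite (metric_sym p.1 y) (metric_sym p.2 (f y)) -hx -hy => ? ? ? ?.
rewrite ler_norml; apply/andP; split; lra.
Qed.

Lemma nonexpansive_eq_dense S T (D : set S) (f g : S -> T) :
  nonexpansive f -> nonexpansive g -> dense D -> (forall x, D x -> f x = g x) ->
  forall x, f x = g x.
Proof.
move=> hf hg dD fg x; apply: mdist_eq_small => e e0.
have e2 : 0 < e / 2 by rewrite divr_gt0.
have [y Dy xy] := dense_mdist dD x e2.
have := metric_triangle (f x) (f y) (g x); rewrite (fg y Dy).
have := hf x y; have := hg y x; rewrite (metric_sym y x) (fg y Dy); lra.
Qed.

Lemma dense_rel_embedding X Y (P : set (dom X * dom Y)) Q :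
  isometric_rel P -> isometric_rel Q ->
  (forall p, P p -> Q (proj p.1, proj p.2)) ->
  dense (fst @` P) -> dense (fst @` Q) ->
  exists f g, [/\ field_embedding f g, forall p, P p -> f p.1 = p.2 &
    forall q, Q q -> g q.1 = q.2].
Proof.
move=> hP hQ PQ dP dQ.
have [f hf fP] := isometric_rel_extends (dom_polish Y).1 hP dP.
have [g hg gQ] := isometric_rel_extends (cod_polish Y).1 hQ dQ.
exists f, g; split=> //; split=> //.
apply: (nonexpansive_eq_dense (D := fst @` P)) => //.
- by move=> x y; rewrite (le_trans (proj_nonexpansive _ _))// hf.
- by move=> x y; rewrite hg; exact: proj_nonexpansive.
- by move=> _ [p Pp <-]; rewrite fP//; exact/esym/(gQ _ (PQ p Pp)).
Qed.

Lemma chain_union S T (P : nat -> set (S * T)) :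
  (forall n, isometric_rel (P n)) -> (forall n, P n `<=` P n.+1) ->
  isometric_rel (\bigcup_n P n).
Proof.
move=> hP PS.
have mono m n : (m <= n)%N -> P m `<=` P n.
  move=> /subnKC <-; elim: (n - m)%N => [|k IH]; first by rewrite addn0.
  by rewrite addnS; exact: subset_trans IH (PS _).
move=> p q [m _ Pm] [n _ Pn]; apply: (hP (maxn m n)).
- exact: mono (leq_maxl _ _) _ Pm.
- exact: mono (leq_maxr _ _) _ Pn.
Qed.

(** A countable list of tasks, each of which can be achieved by enlarging any
partial isomorphism and then persists, is achieved by a single increasing
union.  The union need not be totally bounded. *)
Lemma fulfil_tasks X Y
    (task : nat -> set (dom X * dom Y) -> set (cod X * cod Y) -> Prop) P0 Q0 :
  partial_isometry P0 Q0 ->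
  (forall n P Q, partial_isometry P Q -> exists P' Q',
    [/\ partial_isometry P' Q', P `<=` P', Q `<=` Q' & task n P' Q']) ->
  (forall n P Q P' Q', task n P Q -> P `<=` P' -> Q `<=` Q' -> task n P' Q') ->
  exists P Q, [/\ isometric_rel P, isometric_rel Q,
    forall p, P p -> Q (proj p.1, proj p.2), P0 `<=` P & forall n, task n P Q].
Proof.
move=> PQ0 step mono.
pose good (n : nat) (s : set (dom X * dom Y) * set (cod X * cod Y)) :=
  partial_isometry s.1 s.2.
pose next n (s s' : set (dom X * dom Y) * set (cod X * cod Y)) :=
  [/\ s.1 `<=` s'.1, s.2 `<=` s'.2 & task n s'.1 s'.2].
have [|s s0 hs] := @dependent_chain _ good next (P0, Q0) PQ0.
  by move=> n [P Q] /(step n)[P' [Q' []]]; exists (P', Q').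
have Ps n : (s n).1 `<=` (s n.+1).1 by have [_ []] := hs n.
have Qs n : (s n).2 `<=` (s n.+1).2 by have [_ []] := hs n.
exists (\bigcup_n (s n).1), (\bigcup_n (s n).2); split.
- by apply: chain_union => // n; have [[]] := hs n.
- by apply: chain_union => // n; have [[]] := hs n.
- move=> p [n _ Pp]; exists n => //.
  by have [[_ _ h _ _] _] := hs n; exact: h.
- by move=> p Pp; exists 0%N; rewrite // s0.
- move=> n; have [_ [_ _ t]] := hs n.
  by apply: mono t _ _ => p Pp; exists n.+1.
Qed.

Lemma enumerated_sub T (u : nat -> option T) n (K K' : set T) :
  K `<=` K' -> enumerated u n K -> enumerated u n K'.
Proof. by move=> KK' uK y /uK; exact: KK'. Qed.

(** Universality, by going forth only: exhaust dense sequences of the domain and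
codomain of X, starting from the empty relation. *)
Theorem embeds_in_ultimate X Y : ultimate_urysohn Y ->
  exists (f : dom X -> dom Y) g, field_embedding f g.
Proof.
move=> hY.
have [u hu] := separable_enumeration (dom_polish X).2.
have [v hv] := separable_enumeration (cod_polish X).2.
have empty_tb T : totally_bounded (@set0 T) by move=> e _; exists set0; split.
pose task n (P : set (dom X * dom Y)) (Q : set (cod X * cod Y)) :=
  enumerated u n (fst @` P) /\ enumerated v n (fst @` Q).
have [||| P [Q [hP hQ PQ _ tPQ]]] := @fulfil_tasks X Y task set0 set0.
- by split=> //; rewrite image_set0.
- move=> n P Q PQ; have [P' [Q' []]] := extend_enumerated u v n hY PQ.
  by exists P', Q'; split.
- move=> n P Q P' Q' [uP vQ] PP' QQ'.
  by split; [apply: enumerated_sub uP|apply: enumerated_sub vQ]; exact: image_subset.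
have [||f [g [fg _ _]]] := dense_rel_embedding hP hQ PQ.
- by apply: hu => n; have [] := tPQ n.
- by apply: hv => n; have [] := tPQ n.
by exists f, g.
Qed.

(** The composite f \o f' fixes a dense set, hence every point. *)
Lemma mutual_extensions_surjective S T (P : set (S * T)) (f : S -> T)
    (f' : T -> S) : isometric_embedding f -> isometric_embedding f' ->
  (forall p, P p -> f p.1 = p.2) ->
  (forall p, (P^-1)%relation p -> f' p.1 = p.2) ->
  dense (snd @` P) -> range f = [set: T].
Proof.
move=> hf hf' fP f'P dP; rewrite -subTset => t _; exists (f' t) => //.
apply: (nonexpansive_eq_dense (f := f \o f') (g := id) _ _ dP) => //.
- by move=> x y /=; rewrite hf hf'.
- by move=> _ [[s y] Ps <-] /=; rewrite (f'P (y, s))// (fP (s, y)).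
Qed.

(** Homogeneity, by back and forth.  The backward steps are forward steps for
the inverse relations, so both fields have to be ultimate. *)
Theorem partial_isometry_extends X Y (P0 : set (dom X * dom Y)) Q0 :
  ultimate_urysohn X -> ultimate_urysohn Y -> partial_isometry P0 Q0 ->
  exists f g, field_isometry f g /\ forall p, P0 p -> f p.1 = p.2.
Proof.
move=> hX hY PQ0.
have [u hu] := separable_enumeration (dom_polish X).2.
have [v hv] := separable_enumeration (cod_polish X).2.
have [u' hu'] := separable_enumeration (dom_polish Y).2.
have [v' hv'] := separable_enumeration (cod_polish Y).2.
pose task n (P : set (dom X * dom Y)) (Q : set (cod X * cod Y)) :=
  [/\ enumerated u n (fst @` P), enumerated v n (fst @` Q),
      enumerated u' n (snd @` P) & enumerated v' n (snd @` Q)].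
have [|| P [Q [hP hQ PQ P0P tPQ]]] := fulfil_tasks (task := task) PQ0.
- move=> n P Q PQ; have [P1 [Q1 [PQ1 PP1 QQ1 uP vQ]]] :=
    extend_enumerated u v n hY PQ.
  have [P2 [Q2 [PQ2 PP2 QQ2 uP' vQ']]] :=
    extend_enumerated u' v' n hX (partial_isometry_inv PQ1).
  exists (P2^-1)%relation, (Q2^-1)%relation.
  have P12 : P1 `<=` (P2^-1)%relation by move=> [x y]; exact: (PP2 (y, x)).
  have Q12 : Q1 `<=` (Q2^-1)%relation by move=> [x y]; exact: (QQ2 (y, x)).
  split.
  + exact: partial_isometry_inv.
  + exact: subset_trans PP1 P12.
  + exact: subset_trans QQ1 Q12.
  + split.
    * by apply: enumerated_sub uP; exact: image_subset.
    * by apply: enumerated_sub vQ; exact: image_subset.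
    * by apply: enumerated_sub uP' => _ [[y x] Pyx <-]; exists (x, y).
    * by apply: enumerated_sub vQ' => _ [[c b] Qcb <-]; exists (b, c).
- move=> n P Q P' Q' [h1 h2 h3 h4] PP' QQ'.
  split; [apply: enumerated_sub h1|apply: enumerated_sub h2|
          apply: enumerated_sub h3|apply: enumerated_sub h4]; exact: image_subset.
have [||f [g [fg fP gQ]]] := dense_rel_embedding hP hQ PQ.
- by apply: hu => n; have [] := tPQ n.
- by apply: hv => n; have [] := tPQ n.
have [|||||f' [g' [[hf' hg' _] f'P g'Q]]] :=
  @dense_rel_embedding Y X (P^-1)%relation (Q^-1)%relation.
- exact: isometric_rel_inv.
- exact: isometric_rel_inv.
- by move=> p /PQ.
- by rewrite fst_inv; apply: hu' => n; have [] := tPQ n.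
- by rewrite fst_inv; apply: hv' => n; have [] := tPQ n.
have [hf hg _] := fg.
exists f, g; split; last by move=> p /P0P; exact: fP.
split=> //.
- apply: (mutual_extensions_surjective hf hf' fP f'P).
  by apply: hu' => n; have [] := tPQ n.
- apply: (mutual_extensions_surjective hg hg' gQ g'Q).
  by apply: hv' => n; have [] := tPQ n.
Qed.
End PartialIsometries.

(** * Compact subfields *)

Section Subfields.
Variable R : realType.
Implicit Types T : metricType R.

(** A type of its own, to carry the restricted metric as its canonical
structure. *)
Definition induced T (A : set T) : Type := {x : T | x \in A}.

HB.instance Definition _ T (A : set T) := Choice.on (induced A).

Definition inclusion T (A : set T) (x : induced A) : T := \val x.

Definition induced_dist T (A : set T) (x y : induced A) : R :=
  mdist (inclusion x) (inclusion y).

Fact induced_distxx T (A : set T) (x : induced A) : induced_dist x x = 0.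
Proof. exact: mdistxx. Qed.

Fact induced_dist_eq0 T (A : set T) (x y : induced A) :
  induced_dist x y = 0 -> x = y.
Proof. by move=> h; apply/val_inj/(@mdist_positivity R). Qed.

Fact induced_dist_sym T (A : set T) (x y : induced A) :
  induced_dist x y = induced_dist y x.
Proof. exact: metric_sym. Qed.

Fact induced_dist_triangle T (A : set T) (y x z : induced A) :
  induced_dist x z <= induced_dist x y + induced_dist y z.
Proof. exact: metric_triangle. Qed.

HB.instance Definition _ T (A : set T) := isMetric.Build R (induced A)
  (@induced_distxx T A) (@induced_dist_eq0 T A) (@induced_dist_sym T A)
  (@induced_dist_triangle T A).

Lemma inclusion_isometric T (A : set T) : isometric_embedding (@inclusion T A).
Proof. by []. Qed.

Lemma inclusionP T (A : set T) x : A x -> exists y : induced A, inclusion y = x.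
Proof. by move=> Ax; exists (exist _ x (mem_set Ax)). Qed.

Lemma range_inclusion T (A : set T) : range (@inclusion T A) = A.
Proof.
apply/seteqP; split=> [_ [x _ <-]|x /inclusionP[y <-]]; last by exists y.
by apply: set_mem; exact: (valP x).
Qed.

Lemma compact_induced T (A : set T) : compact A -> compact [set: induced A].
Proof.
move=> cA F FF _.
have [|x [Ax xF]] := cA (@inclusion T A @ F) _.
  by apply: (filterS (F := F) _ filterT) => y _ /=; exact: set_mem (valP y).
have [y yx] := inclusionP Ax; exists y; split=> // B N FB /nbhs_mdistP[e e0 eN].
have [|_ [[z Bz <-] xz]] := xF (@inclusion T A @` B) _ _ (nbhs_mdist x e0).
  by apply: (filterS (F := F) _ FB) => z Bz; exists z.
by exists z; split=> //; apply: eN; rewrite /= -yx in xz.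
Qed.

Lemma induced_proj_nonexpansive (U : metric_field R) (A : set (dom U)) :
  nonexpansive (fun x : induced A => proj (inclusion x)).
Proof. by move=> x y; exact: proj_nonexpansive. Qed.

Definition subfield (U : metric_field R) (A : set (dom U)) (cA : compact A) :=
  MetricField (compact_space_polish (compact_induced cA)) (cod_polish U)
    (@induced_proj_nonexpansive U A).

End Subfields.

(** * Distances between orbits *)

Section Orbits.
Variables (R : realType) (U : metric_field R).
Implicit Types X Y : metric_field R.

(** The ranges of two embeddings of a compact field are compact and isometric
over isometric compact subsets of the codomain of U, so homogeneity applies. *)
Lemma embeddings_conjugate X (f : dom X -> dom U) g f' g' :
  ultimate_urysohn U -> compact_field X ->
  field_embedding f g -> field_embedding f' g' ->
  exists phi psi, @field_isometry R U U phi psi /\ phi \o f = f'.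
Proof.
move=> hU cX [hf hg hfg] [hf' hg' hfg'].
have [|phi [psi [iso phiP]]] := @partial_isometry_extends R U U
    (range (fun x => (f x, f' x)))
    (range (fun x => (g (proj x), g' (proj x)))) hU hU.
  split.
  - by move=> _ _ [x _ <-] [y _ <-] /=; rewrite hf hf'.
  - by move=> _ _ [x _ <-] [y _ <-] /=; rewrite hg hg'.
  - by move=> _ [x _ <-] /=; exists x => //; rewrite hfg hfg'.
  - rewrite image_comp; apply/compact_totally_bounded/nonexpansive_compact_image => //.
    exact: isometric_nonexpansive.
  - rewrite image_comp; apply/compact_totally_bounded/nonexpansive_compact_image => //.
    by move=> x y /=; rewrite hg; exact: proj_nonexpansive.
exists phi, psi; split=> //; apply/funext => x.
by apply: (phiP (f x, f' x)); exists x.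
Qed.

(** A pair of positions of X and Y in U spans a compact subfield of U, in which
both embed; conversely a compact field containing X and Y embeds in U, and by
homogeneity the resulting copies of X and Y are translates of A and A'. *)
Lemma gh_dist_embedded X Y (f : dom X -> dom U) g (f' : dom Y -> dom U) g'
    (A A' : compact_subfields U) :
  ultimate_urysohn U -> compact_field X -> compact_field Y ->
  field_embedding f g -> field_embedding f' g' ->
  sval A = range f -> sval A' = range f' ->
  gh_dist X Y = subfield_dist A A'.
Proof.
move=> hU cX cY fg fg' Af Af'; apply/le_anti/andP; split; apply: ereal_inf_le_tmp.
- move=> _ [phi [psi [[iso _ _] ->]]].
  have cB : compact (sval A `|` phi @` sval A').
    apply: compactU; first exact: (svalP A).
    apply: nonexpansive_compact_image; first exact: (svalP A').
    by apply: isometric_nonexpansive; case: iso.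
  have fB x : (sval A `|` phi @` sval A') (f x) by left; rewrite Af; exists x.
  have fB' y : (sval A `|` phi @` sval A') (phi (f' y)).
    by right; exists (f' y) => //; rewrite Af'; exists y.
  have /choice[h hh] x := inclusionP (fB x).
  have /choice[h' hh'] y := inclusionP (fB' y).
  exists (subfield cB), h, g, h', (psi \o g'); split.
  + exact: compact_induced.
  + case: fg => hf hg hfg; split=> [x y|//|x].
    * by rewrite -hf -!hh.
    * by rewrite -hfg -hh.
  + case: (field_embedding_comp fg' iso) => hf hg hfg; split=> [x y|//|x].
    * by rewrite -hf /= -!hh'.
    * by rewrite -hfg /= -hh'.
  + rewrite -(hausdorff_dist_isometric _ _ (@inclusion_isometric R _ _)).
    congr hausdorff_dist.
    * by rewrite [LHS]Af image_comp; apply: eq_imagel => x _ /=; rewrite hh.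
    * transitivity (range (phi \o f')); first by rewrite Af' image_comp.
      by rewrite image_comp; apply: eq_imagel => y _ /=; rewrite hh'.
- move=> _ [Z [a [b [a' [b' [cZ ab ab' ->]]]]]].
  have [h [k hk]] := embeds_in_ultimate Z hU.
  have [phi [psi [iso phif]]] :=
    embeddings_conjugate hU cX fg (field_embedding_comp ab hk).
  have [phi' [psi' [iso' phif']]] :=
    embeddings_conjugate hU cY fg' (field_embedding_comp ab' hk).
  have [phi1 [psi1 [iso1 _ phi1K _ _]]] := field_isometry_inv iso.
  exists (phi1 \o phi'), (psi1 \o psi'); split.
    exact: field_isometry_comp iso' iso1.
  have [[phi_isom _ _] _ _] := iso; have [h_isom _ _] := hk.
  rewrite -(hausdorff_dist_isometric _ _ phi_isom).
  rewrite -(hausdorff_dist_isometric _ _ h_isom).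
  rewrite Af Af' !image_comp; congr hausdorff_dist.
  + by apply: eq_imagel => x _; rewrite -phif.
  + by apply: eq_imagel => y _ /=; rewrite phi1K -[phi' _]/((phi' \o f') y) phif'.
Qed.

Lemma hausdorff_dist_lt (T : metricType R) (A B : set T) (e : R) :
  (hausdorff_dist A B < e%:E)%E ->
  (forall a, A a -> exists2 b, B b & mdist a b < e) /\
  (forall b, B b -> exists2 a, A a & mdist a b < e).
Proof.
have excess (C D : set T) : (hausdorff_excess C D < e%:E)%E ->
    forall c, C c -> exists2 d, D d & mdist c d < e.
  move=> CD c Cc.
  have : (ereal_inf [set (mdist c d)%:E | d in D] < e%:E)%E.
    apply: le_lt_trans CD; apply: ereal_sup_ubound; right; by exists c.
  by move=> /ereal_inf_lt[_ [d Dd <-]]; rewrite lte_fin; exists d.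
rewrite /hausdorff_dist gt_max => /andP[AB BA]; split; first exact: excess.
by move=> b /(excess _ _ BA)[a Aa ba]; exists a => //; rewrite metric_sym.
Qed.

Lemma hausdorff_distxx (T : metricType R) (A : set T) :
  hausdorff_dist A A = 0%E.
Proof.
suff e0 : hausdorff_excess A A = 0%E by rewrite /hausdorff_dist e0 maxxx.
apply/le_anti/andP; split; last by apply: ereal_sup_ubound; left.
apply: ge_ereal_sup => _ [->//|[a Aa <-]].
by apply: ge_ereal_inf; exists 0%E => //; exists a => //; rewrite mdistxx.
Qed.

Lemma ultra_limit (F : set_system nat) (T : metricType R) (K : set T)
    (u : nat -> T) : UltraFilter F -> compact K -> (forall n, K (u n)) ->
  exists2 x, K x & forall e, 0 < e -> F [set n | mdist x (u n) < e].
Proof.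
move=> UF cK uK.
have [|x [Kx xF]] := cK (u @ F) _.
  by apply: (filterS (F := F) _ filterT) => n _; exact: uK.
exists x => // e e0.
have [//|nF] := in_ultra_setVsetC [set n | mdist x (u n) < e] UF.
have [|_ [[n nxn <-] xn]] :=
  xF (u @` ~` [set n | mdist x (u n) < e]) _ _ (nbhs_mdist x e0).
  by apply: (filterS (F := F) _ nF) => n nxn; exists n.
by [].
Qed.

(** Automorphisms that move A' closer and closer to A have, along an
ultrafilter, a pointwise limit on A'.  It maps A' isometrically onto A and is
compatible with the projections, hence extends to an automorphism. *)
Lemma subfield_dist_eq0 (A A' : compact_subfields U) :
  ultimate_urysohn U -> subfield_dist A A' = 0%E -> same_orbit A' A.
Proof.
move=> hU AA'.
have /choice[phi /choice[psi phiP]] n : exists phi psi,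
    @field_isometry R U U phi psi /\
    ((forall a, sval A a -> exists2 b, sval A' b & mdist a (phi b) < n.+1%:R^-1) /\
     (forall b, sval A' b -> exists2 a, sval A a & mdist a (phi b) < n.+1%:R^-1)).
  have : (subfield_dist A A' < (n.+1%:R^-1)%:E)%E by rewrite AA' lte_fin invr_gt0.
  move=> /ereal_inf_lt[_ [phi [psi [iso ->]]]] /hausdorff_dist_lt[h1 h2].
  exists phi, psi; split=> //; split.
  - by move=> a /h1[_ [b Bb <-]] ab; exists b.
  - by move=> b Bb; apply: h2; exists b.
have [F [UF ooF]] := ultraFilterLemma (F := \oo) _.
have smallF (e : R) : 0 < e -> F [set n | n.+1%:R^-1 < e].
  by move=> e0; apply: ooF; exact: near_infty_natSinv_lt (PosNum e0).
pose tends x y := forall e, 0 < e -> F [set n | mdist (phi n x) y < e].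
have phi_isom n : isometric_embedding (phi n) by have [[[]]] := phiP n.
have proj_phi n x y :
    mdist (proj x) (proj y) = mdist (proj (phi n x)) (proj (phi n y)).
  by have [[[_ h hfg] _ _] _] := phiP n; rewrite !hfg h.
have tends_fst x : sval A' x -> exists2 y, sval A y & tends x y.
  move=> A'x.
  have /choice[a aP] n : exists a, sval A a /\ mdist a (phi n x) < n.+1%:R^-1.
    by have [_ [_ /(_ x A'x)[a Aa ax]]] := phiP n; exists a.
  have [|y Ay ya] := ultra_limit UF (svalP A) (u := a).
    by move=> n; have [] := aP n.
  exists y => // e e0; have e2 : 0 < e / 2 by rewrite divr_gt0.
  apply: filterS (filterI (ya _ e2) (smallF _ e2)) => n /= [ya_n ne].
  have {ne} an := lt_trans (aP n).2 ne; have := metric_triangle y (a n) (phi n x).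
  by rewrite (metric_sym y (phi n x)); lra.
have tends_snd y : sval A y -> exists2 x, sval A' x & tends x y.
  move=> Ay.
  have /choice[b bP] n : exists b, sval A' b /\ mdist y (phi n b) < n.+1%:R^-1.
    by have [_ [/(_ y Ay)[b A'b yb] _]] := phiP n; exists b.
  have [|x A'x xb] := ultra_limit UF (svalP A') (u := b).
    by move=> n; have [] := bP n.
  exists x => // e e0; have e2 : 0 < e / 2 by rewrite divr_gt0.
  apply: filterS (filterI (xb _ e2) (smallF _ e2)) => n /= [xb_n ne].
  have {ne} bn := lt_trans (bP n).2 ne.
  have := metric_triangle (phi n x) (phi n (b n)) y.
  by rewrite phi_isom (metric_sym (phi n (b n)) y); lra.
(* Used for h = id and for h = proj. *)
have close (T : metricType R) (h : dom U -> T) : nonexpansive h ->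
      (forall n x y, mdist (h x) (h y) = mdist (h (phi n x)) (h (phi n y))) ->
    forall x x' y y', tends x x' -> tends y y' ->
    mdist (h x) (h y) = mdist (h x') (h y').
  move=> hh hphi x x' y y' xx' yy'; apply: eq_of_close => e e0.
  have e2 : 0 < e / 2 by rewrite divr_gt0.
  have [n [/= xn yn]] := filter_ex (filterI (xx' _ e2) (yy' _ e2)).
  rewrite (hphi n) (le_trans (mdist_quadrilateral _ _ _ _))//.
  have := hh (phi n x) x'; have := hh (phi n y) y'; lra.
pose P := [set p | [/\ sval A' p.1, sval A p.2 & tends p.1 p.2]].
have fstP : fst @` P = sval A'.
  apply/seteqP; split=> [_ [p [A'p _ _] <-]//|x A'x].
  by have [y Ay xy] := tends_fst x A'x; exists (x, y).
have [|f [g [iso fP]]] := @partial_isometry_extends R U U P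
    [set (proj p.1, proj p.2) | p in P] hU hU.
  split.
  - move=> p q [_ _ pp] [_ _ qq]; apply: (close _ id) pp qq => //.
    by move=> n x y; rewrite phi_isom.
  - move=> _ _ [p [_ _ pp] <-] [q [_ _ qq] <-]; apply: close pp qq => //.
    exact: proj_nonexpansive.
  - by move=> p Pp; exists p.
  - by rewrite fstP; exact/compact_totally_bounded/(svalP A').
  - rewrite image_comp; have -> : [set (fst \o (fun p : dom U * dom U =>
        (proj p.1, proj p.2))) p | p in P] = @proj R U @` (fst @` P).
      by rewrite image_comp.
    rewrite fstP; apply/compact_totally_bounded/nonexpansive_compact_image.
      exact: (svalP A').
    exact: proj_nonexpansive.
exists f, g; split=> //; apply/seteqP; split.
- move=> y Ay; have [x A'x xy] := tends_snd y Ay.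
  by exists x => //; apply: (fP (x, y)); split.
- move=> _ [x A'x <-]; have [y Ay xy] := tends_fst x A'x.
  by rewrite (fP (x, y)).
Qed.

Lemma same_orbit_sym (A B : compact_subfields U) :
  same_orbit A B -> same_orbit B A.
Proof.
move=> [f [g [/field_isometry_inv[f1 [g1 [i1 fK _ _ _]]] BE]]].
exists f1, g1; split=> //; rewrite BE image_comp -[LHS]image_id.
by apply: eq_imagel => x _ /=; rewrite fK.
Qed.

Lemma same_orbit_trans (A B C : compact_subfields U) :
  same_orbit A B -> same_orbit B C -> same_orbit A C.
Proof.
move=> [f [g [fg BE]]] [h [k [hk CE]]].
exists (h \o f), (k \o g); split; first exact: field_isometry_comp fg hk.
by rewrite CE BE image_comp.
Qed.

Lemma orbit_eq (A B : compact_subfields U) : same_orbit A B ->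
  class_of (@same_orbit R U) A = class_of (@same_orbit R U) B.
Proof.
move=> AB; apply: eq_exist; apply/funext => C; apply/propext; split.
- exact/same_orbit_trans/same_orbit_sym.
- exact: same_orbit_trans.
Qed.

Lemma subfield_distxx (A : compact_subfields U) : subfield_dist A A = 0%E.
Proof.
apply/le_anti/andP; split.
  apply: ge_ereal_inf; exists 0%E => //; exists id, id; split.
    exact: field_isometry_id.
  by rewrite image_id hausdorff_distxx.
apply: le_ereal_inf_tmp => _ [phi [psi [_ ->]]].
by rewrite le_max; apply/orP; left; apply: ereal_sup_ubound; left.
Qed.

End Orbits.

Theorem theorem4p11 (R : realType) (U : metric_field R) (hU : ultimate_urysohn U) :
  exists Phi : moduli R -> orbit_space U,
    [/\ forall o : orbit_space U, exists c : moduli R, Phi c = o,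
        forall c c' : moduli R, Phi c = Phi c' <-> moduli_dist c c' = 0%E &
        forall c c' : moduli R,
          orbit_dist (Phi c) (Phi c') = moduli_dist c c'].
Proof.
have /choice[F FP] (X : compact_fields R) : exists A : compact_subfields U,
    exists f g, @field_embedding R (sval X) U f g /\ sval A = range f.
  have [f [g fg]] := embeds_in_ultimate (sval X) hU.
  have cA : compact (range f).
    apply: nonexpansive_compact_image; first exact: (svalP X).
    by apply: isometric_nonexpansive; case: fg.
  by exists (exist _ (range f) cA), f, g.
have dF (X Y : compact_fields R) :
    subfield_dist (F X) (F Y) = gh_dist (sval X) (sval Y).
  have [f [g [fg Af]]] := FP X; have [f' [g' [fg' Af']]] := FP Y.
  by rewrite (gh_dist_embedded hU (svalP X) (svalP Y) fg fg' Af Af').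
pose Phi (c : moduli R) : orbit_space U := class_of _ (F (class_repr c)).
have dPhi c c' : orbit_dist (Phi c) (Phi c') = moduli_dist c c'.
  by rewrite orbit_distE dF.
exists Phi; split=> //.
- move=> o; have [A ->] : exists A, o = class_of _ A.
    by case: o => C hC; have [A CA] := hC; exists A; exact: eq_exist.
  pose X : compact_fields R :=
    exist _ (subfield (svalP A)) (compact_induced (svalP A)).
  exists (class_of _ X).
  have [h [k [hk sh _]]] : isometric_compact_fields X
      (class_repr (class_of (@isometric_compact_fields R) X)).
    rewrite /class_repr; case: cid => /= Y ->.
    by exists id, id; exact: field_isometry_id.
  set Y := class_repr _ in h k hk sh *.
  have [f [g [fg FY]]] := FP Y.
  have incl : @field_embedding R (sval X) U (@inclusion R _ (sval A)) id by split.
  have [phi [psi [iso phif]]] := embeddings_conjugate hU (svalP X) incl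
    (field_embedding_comp hk fg).
  (* Y is isometric to X, so A and F Y are ranges of embeddings of X. *)
  have AF : same_orbit A (F Y).
    exists phi, psi; split=> //; rewrite FY -(range_surj_comp f sh) -phif.
    by rewrite -[in RHS](range_inclusion (sval A)) image_comp.
  by apply: esym; exact: orbit_eq AF.
- move=> c c'; rewrite -dPhi; split=> [->|].
    by rewrite orbit_distE subfield_distxx.
  by rewrite orbit_distE => /(subfield_dist_eq0 hU)/orbit_eq.
Qed.
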